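(* Let $1<q<2$. There exist a dictionary $\mathcal{D}$ in the real Banach space $\ell_q$ and an element $f\in A_1(\mathcal{D})$ such that for all $m=1,2,\dots$ $$\sigma_m(f,\mathcal{D})\ge 2^{-1-1/q}m^{-1/p},\qquad p=\frac{q}{q-1}.$$
   Context: A dictionary in a real Banach space $X$ is a set $\mathcal{D}\subset X$ such that $\|g\|\le 1$ for every $g\in\mathcal{D}$, $g\in\mathcal{D}$ implies $-g\in\mathcal{D}$, and the closed linear span of $\mathcal{D}$ is $X$. $A_1^o(\mathcal{D}):=\{f\in X: f=\sum_{i=1}^\infty c_i g_i,\ g_i\in\mathcal{D},\ c_i\in\mathbb{R},\ \sum_{i=1}^\infty |c_i|\le 1\}$, and $A_1(\mathcal{D})$ is the closure of $A_1^o(\mathcal{D})$ in $X$. The error of best $m$-term approximation is $\sigma_m(f,\mathcal{D}):=\inf_{c_1,\dots,c_m\in\mathbb{R};\ g_1,\dots,g_m\in\mathcal{D}}\left\|f-\sum_{i=1}^m c_i g_i\right\|_X$. *)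

(* Defs.v *)
From HB Require Import structures.
From mathcomp Require Import all_boot all_order all_algebra.
From mathcomp Require Import all_classical all_reals all_analysis.
Set Implicit Arguments.
Unset Strict Implicit.
Unset Printing Implicit Defensive.
Import Order.TTheory GRing.Theory Num.Theory.
Import numFieldNormedType.Exports.
Local Open Scope classical_set_scope.
Local Open Scope ring_scope.

Definition linear_span (R : realType) (X : lmodType R) (D : set X) : set X :=
  [set f | exists (n : nat) (c : 'I_n -> R) (g : 'I_n -> X),
     (forall i, D (g i)) /\ f = \sum_(i < n) c i *: g i].

Definition dictionary (R : realType) (X : completeNormedModType R)
    (D : set X) : Prop :=
  [/\ forall g, D g -> `|g| <= 1,
      forall g, D g -> D (- g)
    & closure (linear_span D) = [set: X]].

Definition A1o (R : realType) (X : completeNormedModType R) (D : set X) :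
    set X :=
  [set f | exists (c : R^nat) (g : X^nat),
     [/\ forall i, D (g i),
         (\sum_(0 <= i <oo) `|c i|%:E <= 1)%E
       & series (fun i => c i *: g i) @ \oo --> f]].

Definition A1 (R : realType) (X : completeNormedModType R) (D : set X) :
    set X := closure (A1o D).

(* A dictionary of a nonzero space is nonempty, so the set below is nonempty and
   bounded below by 0: [inf] never takes its default value. *)
Definition sigma (R : realType) (X : completeNormedModType R) (m : nat) (f : X)
    (D : set X) : R :=
  inf [set e | exists (c : 'I_m -> R) (g : 'I_m -> X),
     (forall i, D (g i)) /\ e = `|f - \sum_(i < m) c i *: g i|].

Lemma lee1_fin (R : realType) (q : R) : 1 <= q -> (1 <= q%:E)%E.
Proof. by rewrite lee_fin. Qed.

(* \ell_q is L^q for the counting measure on nat. Only the empty set is null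
   there, so no quotient is needed and the L^q seminorm is a norm; ell_normE
   gives its expression as a series. *)
Definition ell (R : realType) (q : R) (q1 : 1 <= q) : Type :=
  LfunType (@counting nat R) (lee1_fin q1).

HB.instance Definition _ (R : realType) (q : R) (q1 : 1 <= q) :=
  GRing.Lmodule.on (ell q1).

Lemma cvg_powR (R : realType) (T : Type) (F : set_system T) (f : T -> R)
    (l q : R) :
  ProperFilter F -> 0 < q -> (forall x, 0 <= f x) ->
  f @ F --> l -> (fun x => f x `^ q) @ F --> l `^ q.
Proof.
move=> FF q0 f0 fl.
have : 0 <= l.
  apply: (closed_cvg _ (@closed_ge R 0) _ _ fl); exact: nearW.
rewrite le_eqVlt => /predU1P[l0|l0]; last first.
  have /differentiable_continuous cl : differentiable (fun a : R => a `^ q) l.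
    by apply/derivable1_diffP/derivable_powR; rewrite in_itv/= l0.
  exact: (cvg_comp _ _ fl cl).
rewrite -l0 powR0 ?gt_eqF//; apply/cvgrPdist_lt => e e0.
have d0 : 0 < e `^ q^-1 by rewrite powR_gt0.
move/cvgrPdist_lt : fl => /(_ _ d0); apply: filterS => x.
rewrite -l0 !sub0r !normrN !ger0_norm ?powR_ge0// => fx.
rewrite [ltRHS](_ : e = (e `^ q^-1) `^ q).
  by apply: gt0_ltr_powR; rewrite ?nnegrE// ltW.
by rewrite -powRrM mulVf ?gt_eqF// powRr1// ltW.
Qed.

Section ell_theory.
Context (R : realType) (q : R) (q1 : 1 <= q).
Local Notation N f := ('N[@counting nat R]_(q%:E)[EFin \o f])%E.

Let q0 : 0 < q. Proof. exact: lt_le_trans ltr01 q1. Qed.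

Lemma LnormE (f : nat -> R) :
  N f = ((\sum_(0 <= k <oo) (`|f k| `^ q)%:E) `^ q^-1)%E.
Proof.
by rewrite Lnorm_counting//; under eq_eseriesr do rewrite /= poweR_EFin.
Qed.

Lemma Lnorm_leP (f : nat -> R) (C : R) : 0 <= C ->
  (forall n, \sum_(0 <= k < n) `|f k| `^ q <= C `^ q) <-> (N f <= C%:E)%E.
Proof.
move=> C0; rewrite LnormE; split=> [H|H n].
  have -> : C%:E = ((C `^ q)%:E `^ q^-1)%E.
    by rewrite poweR_EFin -powRrM mulfV ?gt_eqF// powRr1.
  have S0 : (0 <= \sum_(0 <= k <oo) (`|f k| `^ q)%:E)%E.
    by apply: nneseries_ge0 => k _ _; rewrite lee_fin powR_ge0.
  apply: gt0_ler_poweR; rewrite ?invr_ge0 ?(ltW q0)// ?in_itv/= ?S0 ?leey//.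
    by rewrite lee_fin powR_ge0.
  apply: lime_le.
    by apply: is_cvg_nneseries => k _ _; rewrite lee_fin powR_ge0.
  by apply: nearW => n; rewrite /= sumEFin lee_fin.
have S0 : (0 <= \sum_(0 <= k <oo) (`|f k| `^ q)%:E)%E.
  by apply: nneseries_ge0 => k _ _; rewrite lee_fin powR_ge0.
rewrite -lee_fin -poweR_EFin -sumEFin.
apply: (@le_trans _ _ (\sum_(0 <= k <oo) (`|f k| `^ q)%:E)%E).
  by apply: nneseries_lim_ge => k _ _; rewrite lee_fin powR_ge0.
set S := (X in (X <= _)%E).
have -> : S = ((S `^ q^-1) `^ q)%E.
  by rewrite -poweRrM mulVf ?gt_eqF// poweRe1.
apply: gt0_ler_poweR => //; rewrite ?in_itv/= ?leey ?andbT ?poweR_ge0 ?lee_fin//.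
exact: ltW.
Qed.

Lemma Lnorm_coord (f : nat -> R) (k : nat) : (`|f k|%:E <= N f)%E.
Proof.
have := Lnorm_ge0 (@counting nat R) q%:E (EFin \o f).
case E : (N f) => [r| |] // r0; last by rewrite leey.
have /(Lnorm_leP f r0)/(_ k.+1) : (N f <= r%:E)%E by rewrite E.
rewrite big_nat_recr//= => H; rewrite lee_fin leNgt; apply/negP => rf.
have : r `^ q < `|f k| `^ q by apply: gt0_ltr_powR; rewrite ?nnegrE.
rewrite ltNge => /negP; apply; apply: le_trans H.
by rewrite lerDr sumr_ge0// => i _; rewrite powR_ge0.
Qed.

Definition ell_norm (x : ell q1) : R := fine (N x).

Lemma ell_norm_fin (x : ell q1) : (ell_norm x)%:E = N x.
Proof. exact: finite_norm_fine. Qed.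

Lemma ell_normD (x y : ell q1) : ell_norm (x + y) <= ell_norm x + ell_norm y.
Proof. exact: ler_LnormD. Qed.

Lemma ell_normZ (a : R) (x : ell q1) : ell_norm (a *: x) = `|a| * ell_norm x.
Proof. by apply/EFin_inj; rewrite EFinM !ell_norm_fin LnormZ. Qed.

Lemma ell_norm_eq0 (x : ell q1) : ell_norm x = 0 -> x = 0.
Proof.
move=> x0; apply/LfuneqP => k /=; apply/eqP; rewrite -normr_le0 -lee_fin.
by apply: le_trans (Lnorm_coord _ _) _; rewrite -ell_norm_fin x0.
Qed.

HB.instance Definition _ :=
  Lmodule_isNormed.Build R (ell q1) ell_normD ell_normZ ell_norm_eq0.

Lemma ell_normE (x : ell q1) :
  (`|x|%:E = (\sum_(0 <= k <oo) (`|x k| `^ q)%:E) `^ q^-1)%E.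
Proof. by rewrite -LnormE -ell_norm_fin. Qed.

Lemma ell_norm_leP (x : ell q1) (C : R) : 0 <= C ->
  (forall n, \sum_(0 <= k < n) `|x k| `^ q <= C `^ q) <-> `|x| <= C.
Proof. by move=> C0; rewrite Lnorm_leP// -lee_fin -ell_norm_fin. Qed.

Lemma ell_coord (x : ell q1) k : `|x k| <= `|x|.
Proof. by rewrite -lee_fin [leRHS]ell_norm_fin Lnorm_coord. Qed.

Lemma ell_ex (f : nat -> R) : (N f < +oo)%E ->
  exists x : ell q1, forall k, x k = f k.
Proof.
move=> fy; have fL : f \in Lfun (@counting nat R) q%:E.
  by rewrite inE; apply/andP; split; rewrite inE.
by exists (Lfun_Sub (lee1_fin q1) fL) => k; rewrite Lfun_valP.
Qed.

Lemma ell_complete (F : set_system (ell q1)) :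
  ProperFilter F -> cauchy F -> cvg F.
Proof.
move=> FF /cauchyP Fex.
pose coord k (x : ell q1) : R := x k.
have coord_le k (x y : ell q1) : `|coord k x - coord k y| <= `|x - y|.
  exact: (ell_coord (x - y) k).
have coord_cvg k : cvg (coord k @ F).
  apply/cauchy_cvgP/cauchy_exP => e e0.
  have [x Fx] := Fex e e0; exists (coord k x).
  rewrite /fmap /=; apply: filterS Fx => y.
  rewrite -!ball_normE /=; exact: le_lt_trans.
pose l k := lim (coord k @ F).
have dist_l e (x : ell q1) : 0 < e -> F (ball x e) ->
    (N (fun k => (x k - l k)%R) <= e%:E)%E.
  move=> e0 Fx; apply/(Lnorm_leP _ (ltW e0)) => n.
  pose u (y : ell q1) := \sum_(0 <= k < n) `|x k - coord k y| `^ q.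
  have cu : u @ F --> \sum_(0 <= k < n) `|x k - l k| `^ q.
    apply: cvg_big => [|k _]; first exact: add_continuous.
    apply: cvg_powR => //; apply: cvg_norm; apply: cvgB; first exact: cvg_cst.
    exact: coord_cvg.
  apply: (closed_cvg _ (@closed_le R (e `^ q)) _ _ cu).
  apply: filterS Fx => y; rewrite -ball_normE /= => /ltW xy.
  exact: (proj2 (ell_norm_leP (x - y) (ltW e0)) xy n).
have [x1 Fx1] := Fex 1 ltr01.
have [d dE] : exists d : ell q1, forall k, d k = x1 k - l k.
  by apply: ell_ex; apply: le_lt_trans (dist_l _ _ ltr01 Fx1) (ltry _).
pose L : ell q1 := x1 - d.
have LE k : L k = l k by rewrite [LHS](_ : _ = x1 k - d k)// dE subKr.
apply/cvg_ex; exists L; apply/cvgrPdist_le => e e0.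
have e20 : 0 < e / 2 by rewrite divr_gt0.
have [x Fx] := Fex _ e20.
have xL : `|x - L| <= e / 2.
  rewrite -lee_fin [leLHS]ell_norm_fin.
  rewrite [leLHS](_ : _ = N (fun k => (x k - l k)%R)) ?dist_l//.
  by apply: eq_Lnorm => k; rewrite /= -LE.
apply: filterS Fx => y; rewrite -ball_normE /= => /ltW xy.
rewrite (splitr e) (le_trans (ler_distD x _ _))// lerD//.
by rewrite distrC.
Qed.

HB.instance Definition _ := Uniform_isComplete.Build (ell q1) ell_complete.

End ell_theory.

(* Main.v *)
Require Import Defs.
From mathcomp Require Import all_boot all_order all_algebra.
From mathcomp Require Import all_classical all_reals all_analysis.
From mathcomp Require Import ring lra.
Import Order.TTheory GRing.Theory Num.Theory.
Import numFieldNormedType.Exports.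
Local Open Scope classical_set_scope.
Local Open Scope ring_scope.

(** Write e_0, e_1, ... for the unit vectors of ell_q and b = 2^(-1/q).  The
    dictionary consists of the vectors +-g_k with g_k = b (e_0 + e_(k+1)), which
    have norm 1, and the element is f = b e_0.

    The average of n of the g_k is b e_0 plus a vector with n coordinates equal
    to b/n, whose norm b n^(1/q - 1) tends to 0 because q > 1.  Hence f, which
    does not depend on n, is a limit of convex combinations of the dictionary
    ([basis0_A1]).  The same averages put e_0, hence every e_k, in the closed
    span, and truncations of sequences are dense ([spikes_dictionary]).

    A combination of m dictionary elements does better than the average of m of
    the g_k by at most a constant factor.
    Let x be the residual of such a combination, and let J be the set of the at
    most m coordinates j > 0 that it uses.  The functional
    x |-> x_0 - sum_(j in J) x_j vanishes on every g_k with k+1 in J, since g_k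
    has equal entries at 0 and k+1; so it takes the value b on x.  Hoelder's
    inequality bounds the sum over J by m^(1 - 1/q) |x| ([sum_norm_le]), and
    |x_0| <= |x|, so b <= 2 m^(1 - 1/q) |x| ([spikes_residual]).  As
    1 - 1/q = 1/p, this is the claimed bound. *)

Set Implicit Arguments.
Unset Strict Implicit.

(** * Sums over duplicate-free lists *)

(** Compares a sum over a finite support with a partial sum of a series, in
    either direction. *)
Lemma ler_sum_uniq (R : realType) (I : eqType) (r s : seq I) (F : I -> R) :
  uniq r -> uniq s -> (forall i, 0 <= F i) ->
  (forall i, i \in r -> i \notin s -> F i = 0) ->
  \sum_(i <- r) F i <= \sum_(i <- s) F i.
Proof.
move=> ur us F0 Frs; rewrite (bigID (mem s))/= [X in _ + X]big1_seq ?addr0.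
  rewrite -big_filter [leRHS](bigID (mem r))/=.
  rewrite -[X in _ <= X + _]big_filter.
  rewrite (@perm_big _ _ _ _ _ [seq x <- s | x \in r]).
    by rewrite lerDl sumr_ge0.
  by apply: uniq_perm => [||i]; rewrite ?filter_uniq// !mem_filter andbC.
by move=> i /andP[/= si ri]; exact: Frs.
Qed.

(** * Spans and averages in a Banach space *)

Section normed_space.
Context (R : realType) (X : completeNormedModType R).
Implicit Types (D A : set X) (x y z : X).

Lemma closure_approx A x :
  (forall e, 0 < e -> exists2 z, A z & `|x - z| <= e) -> closure A x.
Proof.
move=> H B /nbhs_ballP[e /= e0 eB].
have [z Az xz] := H _ (divr_gt0 e0 (ltr0n _ 2)).
exists z; split=> //; apply: eB; rewrite -ball_normE /=.
by rewrite (le_lt_trans xz)// ltr_pdivrMr// ltr_pMr// ltr1n.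
Qed.

Lemma linear_span_gen D x : D x -> linear_span D x.
Proof.
move=> Dx; exists 1%N, (fun=> 1), (fun=> x); split=> //.
by rewrite big_ord1 scale1r.
Qed.

Lemma linear_span0 D : linear_span D 0.
Proof.
exists 0%N, (fun=> 0), (fun=> 0); split; first by case.
by rewrite big_ord0.
Qed.

Lemma linear_spanZ D (a : R) x : linear_span D x -> linear_span D (a *: x).
Proof.
move=> [n [c [g [Dg ->]]]]; exists n, (fun i => a * c i), g; split=> //.
by rewrite scaler_sumr; apply: eq_bigr => i _; rewrite scalerA.
Qed.

Lemma linear_spanD D x y :
  linear_span D x -> linear_span D y -> linear_span D (x + y).
Proof.
move=> [n [c [g [Dg ->]]]] [n' [c' [g' [Dg' ->]]]].
exists (n + n')%N,
  (fun i => match fintype.split i with inl j => c j | inr j => c' j end),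
  (fun i => match fintype.split i with inl j => g j | inr j => g' j end).
split; first by move=> i; case: (fintype.split i).
rewrite big_split_ord/=; congr (_ + _); apply: eq_bigr => i _.
  by rewrite (unsplitK (inl i)).
by rewrite (unsplitK (inr i)).
Qed.

Lemma linear_span_sum D (I : Type) (r : seq I) (P : pred I) (F : I -> X) :
  (forall i, P i -> linear_span D (F i)) ->
  linear_span D (\sum_(i <- r | P i) F i).
Proof.
by move=> DF; apply: big_ind => //; [exact: linear_span0|exact: linear_spanD].
Qed.

Lemma A1o_average D (g : nat -> X) (n : nat) : (forall i, D (g i)) ->
  A1o D (n.+1%:R^-1 *: \sum_(0 <= i < n.+1) g i).
Proof.
move=> Dg; pose c i : R := if (i < n.+1)%N then n.+1%:R^-1 else 0.
exists c, g; split=> //.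
- rewrite (@nneseries_split _ _ 0 n.+1); last by move=> k _; rewrite lee_fin.
  rewrite add0n [X in (_ + X)%E]eseries0 ?adde0; last first.
    by move=> k nk _; rewrite /c ltnNge nk/= normr0.
  rewrite big_mkord (eq_bigr (fun=> (n.+1%:R^-1)%:E)); last first.
    by move=> i _; rewrite /c ltn_ord ger0_norm// invr_ge0.
  by rewrite sumEFin lee_fin sumr_const card_ord -[leLHS]mulr_natr mulVf ?pnatr_eq0.
- apply: cvg_near_cst; exists n.+1 => // m /= nm.
  rewrite /series/= (big_cat_nat (leq0n n.+1) nm)//= [X in _ + X]big_nat_cond.
  rewrite [X in _ + X]big1 ?addr0; last first.
    by move=> i /andP[/andP[ni _] _]; rewrite /c ltnNge ni/= scale0r.
  rewrite scaler_sumr; apply: eq_big_nat => i /andP[_ ni].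
  by rewrite /c ni.
Qed.

End normed_space.

(** * Coordinates and finite supports in ell_q *)

Section ell_basis.
Context (R : realType) (q : R) (q1 : 1 < q).
Local Notation ellq := (ell (ltW q1)).
Local Notation r := (1 - q^-1).
Implicit Types (x y : ellq).

Let q0 : 0 < q. Proof. exact: lt_trans ltr01 q1. Qed.

Let r0 : 0 < r. Proof. by rewrite subr_gt0 invf_lt1. Qed.

Lemma ellDE x y k : (x + y) k = x k + y k. Proof. by []. Qed.

Lemma ellNE x k : (- x) k = - x k. Proof. by []. Qed.

Lemma ellZE (a : R) x k : (a *: x) k = a * x k. Proof. by []. Qed.

Lemma ell_sumE (I : Type) (s : seq I) (F : I -> ellq) k :
  (\sum_(i <- s) F i) k = \sum_(i <- s) F i k.
Proof. by elim/big_rec2 : _ => // i y z _ <-. Qed.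

Lemma sum_powR_le_norm x (s : seq nat) :
  uniq s -> \sum_(k <- s) `|x k| `^ q <= `|x| `^ q.
Proof.
move=> us; have /(ell_norm_leP x (normr_ge0 x)) H := lexx `|x|.
apply: le_trans (H (\max_(k <- s) k).+1); apply: ler_sum_uniq => //.
  exact: iota_uniq.
move=> k ks; rewrite mem_index_iota/= ltnS.
by rewrite (@leq_bigmax_seq _ s predT (fun k => k)).
Qed.

Lemma norm_le_supp x (s : seq nat) (C : R) : 0 <= C -> uniq s ->
  (forall k, k \notin s -> x k = 0) ->
  \sum_(k <- s) `|x k| `^ q <= C `^ q -> `|x| <= C.
Proof.
move=> C0 us xs H; apply/ell_norm_leP => // n; apply: le_trans H.
apply: ler_sum_uniq => //; first exact: iota_uniq.
by move=> k _ /xs ->; rewrite normr0 powR0// gt_eqF.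
Qed.

(** Hoelder's inequality against the indicator of [s].  Young's inequality
    a <= a^q/q + (1 - 1/q) is summed over [s] with a = |x k| / t; the right-hand
    side totals at most m when t = |x| m^(-1/q). *)
Lemma sum_norm_le x (s : seq nat) (m : nat) : (0 < m)%N -> uniq s ->
  (size s <= m)%N -> \sum_(k <- s) `|x k| <= m%:R `^ r * `|x|.
Proof.
move=> m0 us sm.
have [->|x0] := eqVneq x 0.
  by rewrite big1 ?normr0 ?mulr0 // => k _; rewrite -[LHS]/`|0 : R| normr0.
have m0' : 0 < m%:R :> R by rewrite ltr0n.
pose t : R := `|x| / m%:R `^ q^-1.
have t0 : 0 < t by rewrite divr_gt0 ?normr_gt0 ?powR_gt0.
have tq : `|x| `^ q = m%:R * t `^ q.
  have -> : `|x| = t * m%:R `^ q^-1 by rewrite divfK ?gt_eqF ?powR_gt0.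
  by rewrite powRM ?powR_ge0 ?(ltW t0)// -powRrM mulVf ?gt_eqF// powRr1 1?mulrC// ltW.
have -> : m%:R `^ r * `|x| = m%:R * t.
  rewrite powRD ?powRr1 ?ltW//; last by rewrite pnatr_eq0 -lt0n m0 implybT.
  by rewrite powRN /t; ring.
rewrite -ler_pdivrMr// mulr_suml.
have young k : `|x k| / t <= (`|x k| / t) `^ q / q + r.
  have := @conjugate_powR R (`|x k| / t) 1 q r^-1.
  rewrite mulr1 powR1 mul1r invrK; apply=> //.
  - by rewrite divr_ge0// ltW.
  - by rewrite invr_gt0.
  - by rewrite addrC subrK.
apply: (le_trans (ler_sum _ (fun k _ => young k))).
rewrite big_split/= -mulr_suml.
have -> : m%:R = m%:R / q + m%:R * r :> R by ring.
rewrite big_const_seq count_predT iter_addr_0 -[X in _ + X]mulr_natl.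
rewrite lerD// ?ler_pM2r ?invr_gt0 ?ler_nat//.
under eq_bigr do rewrite powRM// ?invr_ge0 ?(ltW t0)//.
rewrite -mulr_suml -[t^-1]powR_inv1 ?(ltW t0)// -powRrM mulN1r powRN.
by rewrite ler_pdivrMr ?powR_gt0// -tq sum_powR_le_norm.
Qed.

(** * Unit vectors *)

Lemma basis_subproof k : exists x : ellq, forall j, x j = (j == k)%:R.
Proof.
apply: ell_ex; apply: le_lt_trans (ltry 1).
apply/(Lnorm_leP (ltW q1) _ ler01) => n.
rewrite powR1; apply: (@le_trans _ _ (\sum_(j <- [:: k]) `|(j == k)%:R : R| `^ q)).
  apply: ler_sum_uniq => //; first exact: iota_uniq.
  by move=> j _; rewrite inE => /negPf ->; rewrite normr0 powR0// gt_eqF.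
by rewrite big_seq1 eqxx normr1 powR1.
Qed.

Definition basis k : ellq := sval (cid (basis_subproof k)).

Lemma basisE k j : basis k j = (j == k)%:R.
Proof. by rewrite /basis; case: cid. Qed.

(** The tail beyond [n] has q-th power sum at most the defect of the n-th
    partial sum from the supremum of all partial sums, and this supremum is
    finite as it is bounded by |x|^q. *)
Lemma truncation_approx x (e : R) : 0 < e ->
  exists n, `|x - \sum_(0 <= k < n) x k *: basis k| <= e.
Proof.
move=> e0; pose S n := \sum_(0 <= k < n) `|x k| `^ q.
have ubS : has_ubound (range S).
  by exists (`|x| `^ q) => _ [n _ <-]; apply: sum_powR_le_norm; exact: iota_uniq.
have [_ [n _ <-] nS] : exists2 s, range S s & sup (range S) - e `^ q < s.
  by apply: sup_adherent; [rewrite powR_gt0|split=> //; exists (S 0%N), 0%N].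
exists n; apply/ell_norm_leP; first exact: ltW.
move=> m; set y := x - _.
have yE (k : nat) : y k = if (k < n)%N then 0 else x k.
  rewrite /y ellDE ellNE ell_sumE.
  rewrite (eq_bigr (fun i => x i * (k == i)%:R)); last first.
    by move=> i _; rewrite ellZE basisE.
  case: ltnP => kn.
    rewrite (bigD1_seq k) ?iota_uniq ?mem_index_iota//= eqxx mulr1.
    rewrite big1 ?addr0 ?subrr// => i ik.
    by rewrite eq_sym (negPf ik) mulr0.
  rewrite big1_seq ?subr0// => i; rewrite mem_index_iota/= => ni.
  by rewrite gtn_eqF ?mulr0// (leq_trans ni).
clearbody y; have : S n + \sum_(0 <= k < m) `|y k| `^ q <= S (n + m)%N.
  rewrite [leRHS](big_cat_nat (leq0n n) (leq_addr m n))/= lerD2l.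
  apply: (@le_trans _ _ (\sum_(n <= k < n + m) `|y k| `^ q)).
    apply: ler_sum_uniq; rewrite ?iota_uniq// => k.
    rewrite !mem_index_iota/= => km; rewrite yE; case: (ltnP k n) => [_ _|_].
      by rewrite normr0 powR0 ?gt_eqF.
    by rewrite (leq_trans km) ?leq_addl.
  rewrite le_eqVlt; apply/orP; left; apply/eqP; apply: eq_big_nat => k /andP[nk _].
  by rewrite yE ltnNge nk.
have : S (n + m)%N <= sup (range S) by apply: ub_le_sup => //; exists (n + m)%N.
by move: nS; lra.
Qed.

Lemma norm_sum_basis n : `|\sum_(0 <= k < n) basis k.+1| <= n%:R `^ q^-1.
Proof.
have xE j : (\sum_(0 <= k < n) basis k.+1) j = (j \in iota 1 n)%:R.
  rewrite ell_sumE mem_iota add1n ltnS; case: j => [|j]/=.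
    by rewrite big1// => i _; rewrite basisE.
  case: (ltnP j n) => jn.
    rewrite (bigD1_seq j) ?iota_uniq ?mem_index_iota//= basisE eqxx.
    by rewrite big1 ?addr0// => i ij; rewrite basisE eqSS eq_sym (negPf ij).
  rewrite big1_seq// => i; rewrite mem_index_iota/= => ni.
  by rewrite basisE eqSS; case: eqP ni jn => // ->; case: ltnP.
apply: (@norm_le_supp _ (iota 1 n)); rewrite ?powR_ge0 ?iota_uniq//.
  by move=> k kn; rewrite xE (negPf kn).
rewrite -powRrM mulVf ?gt_eqF// powRr1//.
rewrite big_seq (eq_bigr (fun=> 1)) => [|k kn]; last by rewrite xE kn normr1 powR1.
by rewrite -big_seq big_const_seq count_predT size_iota iter_addr_0.
Qed.

(** * The dictionary *)

Local Notation b := (2 `^ (- q^-1) : R).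

(** The factor [b] is the inverse of the norm of [basis 0 + basis k.+1]. *)
Definition spike k : ellq := b *: (basis 0 + basis k.+1).

Definition spikes : set ellq := [set g | exists k, g = spike k \/ g = - spike k].

Lemma norm_spike k : `|spike k| <= 1.
Proof.
rewrite normrZ ger0_norm ?powR_ge0// powRN ler_pdivrMl ?powR_gt0// mulr1.
apply: (@norm_le_supp _ [:: 0%N; k.+1]) => //.
  move=> j; rewrite !inE negb_or => /andP[j0 jk].
  by rewrite ellDE !basisE (negPf j0) (negPf jk) addr0.
rewrite big_cons big_seq1 !ellDE !basisE !eqxx/= addr0 add0r normr1 powR1.
by rewrite -powRrM mulVf ?gt_eqF// powRr1.
Qed.

(** The [basis 0] parts of the average reproduce [b *: basis 0] exactly; the
    error is [- b] times the average of n.+1 distinct unit vectors, which is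
    small for q > 1. *)
Lemma basis0_average n :
  `|b *: basis 0 - n.+1%:R^-1 *: \sum_(0 <= k < n.+1) spike k| <= n.+1%:R `^ (- r).
Proof.
have n0 : n.+1%:R != 0 :> R by rewrite pnatr_eq0.
have -> : b *: basis 0 - n.+1%:R^-1 *: \sum_(0 <= k < n.+1) spike k =
    - (b / n.+1%:R) *: \sum_(0 <= k < n.+1) basis k.+1.
  rewrite /spike -scaler_sumr big_split/= big_const_nat subn0 iter_addr_0.
  rewrite scalerA [_^-1 * b]mulrC scalerDr -[basis 0 *+ _]scaler_nat scalerA.
  by rewrite divfK// opprD addrA subrr add0r scaleNr.
rewrite normrZ normrN ger0_norm ?divr_ge0 ?powR_ge0//.
rewrite opprB powRD ?n0 ?implybT// powR_inv1//.
rewrite [n.+1%:R `^ _ / _]mulrC ler_pM ?divr_ge0 ?powR_ge0//; last first.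
  exact: norm_sum_basis.
rewrite ler_piMl// powRN invf_le1 ?powR_gt0//.
by rewrite -[leLHS](@powRr0 _ 2) ler_powR ?ler1n// invr_ge0 ltW.
Qed.

Lemma ex_natpowRN_le (e : R) : 0 < e -> exists n, n.+1%:R `^ (- r) <= e.
Proof.
move=> e0; exists (Num.truncn (e `^ (- r^-1))).
have := truncnS_gt (e `^ (- r^-1)); set n := Num.truncn _ => /ltW en.
rewrite powRN -[leRHS]invrK lef_pV2 ?posrE ?invr_gt0 ?powR_gt0//.
have -> : e^-1 = (e `^ (- r^-1)) `^ r.
  by rewrite -powRrM mulNr mulVf ?gt_eqF// powR_inv1// ltW.
by apply: ge0_ler_powR; rewrite ?nnegrE ?powR_ge0 ?(ltW r0).
Qed.

Lemma basis0_A1 : A1 spikes (b *: basis 0).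
Proof.
apply: closure_approx => e /ex_natpowRN_le[n ne].
exists (n.+1%:R^-1 *: \sum_(0 <= i < n.+1) spike i).
  by apply: A1o_average => i; exists i; left.
exact: le_trans (basis0_average n) ne.
Qed.

(** For density, a truncation of [x] is rewritten with [spike]s: each
    [basis k.+1] is [b^-1 *: spike k] minus [basis 0], so all that remains is a
    multiple of [basis 0], which averages of [spike]s approximate. *)
Lemma spikes_dictionary : dictionary spikes.
Proof.
split.
- by move=> g [k [|]->]; rewrite ?normrN norm_spike.
- by move=> g [k [|]->]; exists k; [right|left; rewrite opprK].
rewrite -subTset => x _; apply: closure_approx => e e0.
have e20 : 0 < e / 2 by rewrite divr_gt0.
have [n xn] := truncation_approx x e20.
have b0 : b != 0 by rewrite gt_eqF ?powR_gt0.
(* [a] is what is left on [basis 0] after each other x k *: basis k has been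
   replaced by a multiple of a spike *)
pose a : R := \sum_(0 <= k < n) if k == 0%N then x k else - x k.
(* the error of the average is multiplied by |a / b|, possibly 0: hence the + 1 *)
have [N aN] := @ex_natpowRN_le (e / 2 / (`|a / b| + 1))
  (divr_gt0 e20 (ltr_wpDl (normr_ge0 _) ltr01)).
pose w := N.+1%:R^-1 *: \sum_(0 <= k < N.+1) spike k.
pose u := \sum_(0 <= k < n)
  if k == 0%N then 0 else (x k / b) *: spike k.-1.
have spk k : linear_span spikes (spike k).
  by apply: linear_span_gen; exists k; left.
exists (u + (a / b) *: w).
  apply: linear_spanD.
    apply: linear_span_sum => k _; case: ifP => _; first exact: linear_span0.
    exact: linear_spanZ.
  do 2 apply: linear_spanZ; apply: linear_span_sum => k _; exact: spk.
have uE : \sum_(0 <= k < n) x k *: basis k = u + a *: basis 0.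
  rewrite /u /a scaler_suml -big_split/=; apply: eq_bigr => -[|k] _/=.
    by rewrite add0r.
  by rewrite /spike scalerA divfK// scalerDr scaleNr addrAC subrr add0r.
have -> : x - (u + (a / b) *: w) =
    (x - \sum_(0 <= k < n) x k *: basis k) + (a / b) *: (b *: basis 0 - w).
  by rewrite uE scalerBr [(a / b) *: (b *: _)]scalerA divfK// !opprD !addrA subrK.
rewrite (le_trans (ler_normD _ _))// [leRHS](splitr e) lerD// normrZ.
have := le_trans (basis0_average N) aN.
rewrite ler_pdivlMr ?ltr_wpDl// -/w => H; apply: le_trans H.
by rewrite mulrC ler_wpM2l// lerDl.
Qed.

(** * The approximation bound *)

(** The functional subtracting from coordinate 0 the coordinates in [J] kills
    each [spike k] with [k.+1] in [J], so it takes the same value [b] on the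
    residual as on [b *: basis 0].  Its norm is at most 1 + m^r <= 2 m^r. *)
Lemma spikes_residual (m : nat) (c : 'I_m -> R) (g : 'I_m -> ellq) :
  (0 < m)%N -> (forall i, spikes (g i)) ->
  b <= 2 * m%:R `^ r * `|b *: basis 0 - \sum_(i < m) c i *: g i|.
Proof.
move=> m0 Dg.
(* the sign of each g i is absorbed in its coefficient *)
have /choice[h hE] i : exists ak : R * nat, c i *: g i = ak.1 *: spike ak.2.
  have [k [|]->] := Dg i; first by exists (c i, k).
  by exists (- c i, k); rewrite scalerN scaleNr.
rewrite (eq_bigr _ (fun i _ => hE i)).
set x := b *: basis 0 - _.
(* the g i may repeat; [undup] makes a repeated coordinate count once *)
pose J := undup [seq (h i).2.+1 | i <- enum 'I_m].
have hJ i : (h i).2.+1 \in J.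
  by rewrite mem_undup (map_f (fun i => (h i).2.+1))// mem_enum.
have Jm : (size J <= m)%N.
  by rewrite (leq_trans (size_undup _))// size_map size_enum_ord.
have x0 : x 0%N = b - b * \sum_(i < m) (h i).1.
  rewrite /x ellDE ellNE ellZE ell_sumE basisE eqxx mulr1 mulr_sumr; congr (_ - _).
  by apply: eq_bigr => i _; rewrite !ellZE ellDE !basisE/= addr0 mulr1 mulrC.
have xJ : \sum_(j <- J) x j = - (b * \sum_(i < m) (h i).1).
  transitivity (- \sum_(j <- J) \sum_(i < m) (h i).1 * (b * (j == (h i).2.+1)%:R)).
    rewrite -sumrN !big_seq; apply: eq_bigr => -[|j] jJ.
      by move: jJ; rewrite mem_undup => /mapP[].
    rewrite /x ellDE ellNE ellZE ell_sumE basisE mulr0 add0r; congr (- _).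
    by apply: eq_bigr => i _; rewrite !ellZE ellDE !basisE/= add0r.
  rewrite exchange_big mulr_sumr; congr (- _); apply: eq_bigr => i _ /=.
  rewrite (bigD1_seq (h i).2.+1) ?undup_uniq//= eqxx mulr1 big1 ?addr0 1?mulrC//.
  by move=> j /negPf ->; rewrite !mulr0.
have -> : b = x 0%N - \sum_(j <- J) x j by rewrite x0 xJ; ring.
rewrite (le_trans (ler_norm _))// (le_trans (ler_normB _ _))//.
rewrite -mulrA mulr_natl mulr2n lerD//; last first.
  by rewrite (le_trans (ler_norm_sum _ _ _))// sum_norm_le// undup_uniq//.
rewrite (le_trans (ell_coord x 0))// ler_peMl//.
by rewrite -[leLHS](@powRr0 _ m%:R) ler_powR ?ler1n// ltW.
Qed.

End ell_basis.

Theorem theorem3p2 (R : realType) (q p : R) (q1 : 1 < q) (q2 : q < 2)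
    (hp : p = q / (q - 1)) :
  exists (D : set (ell (ltW q1))) (f : ell (ltW q1)),
    [/\ dictionary D, A1 D f &
      forall m : nat, (0 < m)%N ->
        2 `^ (- 1 - 1 / q) * m%:R `^ (- (1 / p)) <= sigma m f D].
Proof.
exists (@spikes R q q1), (2 `^ (- q^-1) *: basis q1 0); split.
- exact: spikes_dictionary.
- exact: basis0_A1.
move=> m m0; rewrite /sigma; apply: lb_le_inf.
  exists `|2 `^ (- q^-1) *: basis q1 0 - \sum_(i < m) 0 *: spike q1 0|.
  by exists (fun=> 0), (fun=> spike q1 0); split=> // i; exists 0%N; left.
move=> _ [c [g [Dg ->]]].
have := spikes_residual c m0 Dg; set N := `|_|.
have -> : 1 / p = 1 - q^-1.
  have q0 : q != 0 by rewrite gt_eqF// (lt_trans ltr01).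
  have q10 : q - 1 != 0 by rewrite subr_eq0 gt_eqF.
  by rewrite hp; field; rewrite q0 q10.
have -> : - 1 - 1 / q = - q^-1 - 1 by rewrite div1r addrC.
rewrite [2 `^ (_ - 1)]powRD ?pnatr_eq0 ?implybT// powR_inv1// (powRN m%:R) => H.
rewrite ler_pdivrMr ?powR_gt0 ?ltr0n// ler_pdivrMr//.
by apply: le_trans H _; rewrite mulrC mulrCA mulrC.
Qed.
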